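(* Let $n\ge 1$ be an integer, let $Q=[a,b]\times[c,d]$ and let $f:Q\to\mathbb{R}$ have continuous partial derivatives of order $n-1$. Suppose that the $n$-th partial derivatives $D^n_jf=\frac{\partial^n f}{\partial t^{n-j}\partial s^{j}}$, $j=0,1,\dots,n$, are of bounded bivariation on $Q$. For $k\in\{0,1,\dots,n\}$ put $$\mathcal{F}^n_M(f;Q)=\frac{1}{(b-a)(d-c)}\int_c^d\int_a^b M_n(t,s)\,d_td_s\big(D^n_kf(t,s)\big),$$ with the kernel $M_n$ defined in the context. Then for every $k\in\{0,1,\dots,n\}$, $$\big|\mathcal{F}^n_M(f;Q)\big|\le\frac{(b-a)^n(d-c)^n}{2^{2n+2}\,n!}\cdot\bigvee_c^d\bigvee_a^b\big(D^n_kf\big).$$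
   Context: Here $a<b$, $c<d$ are real numbers and $Q=[a,b]\times[c,d]$. For a grid partition $P$: $a=x_0<\dots<x_N=b$, $c=y_0<\dots<y_M=d$ of $Q$ and $g:Q\to\mathbb{R}$, put $\Delta_{11}g(x_i,y_j)=g(x_{i-1},y_{j-1})-g(x_{i-1},y_j)-g(x_i,y_{j-1})+g(x_i,y_j)$. The total bivariation of $g$ on $Q$ is $\bigvee_c^d\bigvee_a^b(g)=\sup_P\sum_{i=1}^N\sum_{j=1}^M|\Delta_{11}g(x_i,y_j)|$, and $g$ is of bounded bivariation on $Q$ if this is finite. The integral $\int_c^d\int_a^b h(t,s)\,d_td_s\,g(t,s)$ is the Riemann--Stieltjes double integral, i.e. the limit, as the mesh of the partition tends to $0$, of the sums $\sum_{i,j}h(\xi_{ij},\eta_{ij})\,\Delta_{11}g(x_i,y_j)$ with $(\xi_{ij},\eta_{ij})\in[x_{i-1},x_i]\times[y_{j-1},y_j]$. The kernel is $$M_n(t,s)=\frac{(b-a)(d-c)}{4\,n!}\begin{cases}\big(\frac{a+b}{2}-t\big)^n\big(\frac{c+d}{2}-s\big)^n, & a\le t\le\frac{a+b}{2},\ c\le s\le\frac{c+d}{2},\\ (-1)^{n+1}\big(t-\frac{a+b}{2}\big)^n\big(\frac{c+d}{2}-s\big)^n, & \frac{a+b}{2}<t\le b,\ c\le s\le\frac{c+d}{2},\\ (-1)^{n+1}\big(\frac{a+b}{2}-t\big)^n\big(s-\frac{c+d}{2}\big)^n, & a\le t\le\frac{a+b}{2},\ \frac{c+d}{2}<s\le d,\\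 \big(t-\frac{a+b}{2}\big)^n\big(s-\frac{c+d}{2}\big)^n, & \frac{a+b}{2}<t\le b,\ \frac{c+d}{2}<s\le d.\end{cases}$$ *)

(* Defs.v *)
From HB Require Import structures.
From mathcomp Require Export all_boot all_order all_algebra.
From mathcomp Require Export all_classical all_reals all_analysis.
Set Implicit Arguments.
Unset Strict Implicit.
Unset Printing Implicit Defensive.
Export Order.TTheory GRing.Theory Num.Theory.
Export numFieldNormedType.Exports.

Local Open Scope classical_set_scope.
Local Open Scope ring_scope.

Definition rect (R : realType) (a b c d : R) : set (R * R) :=
  `[a, b]%classic `*` `[c, d]%classic.

(* A grid on [a, b] x [c, d] is a pair xs, ys of sequences such that
   itv_partition a b xs and itv_partition c d ys (x_0 = a and y_0 = c are left
   implicit); node b (a :: _) is the convention of the library's variation. *)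
Definition node (R : realType) (a b : R) (xs : seq R) (i : nat) : R :=
  nth b (a :: xs) i.

Definition mesh (R : realType) (a b : R) (xs : seq R) : R :=
  \big[Num.max/0]_(i < size xs) (node a b xs i.+1 - node a b xs i).

(* The increment of g over the cell with lower left corner (x_i, y_j); indices
   start at 0. *)
Definition Delta11 (R : realType) (a b c d : R) (g : R * R -> R)
    (xs ys : seq R) (i j : nat) : R :=
  let x := node a b xs in
  let y := node c d ys in
  g (x i, y j) - g (x i, y j.+1) - g (x i.+1, y j) + g (x i.+1, y j.+1).

Definition bivariation (R : realType) (a b c d : R) (g : R * R -> R)
    (xs ys : seq R) : R :=
  \sum_(i < size xs) \sum_(j < size ys) `|Delta11 a b c d g xs ys i j|.

Definition total_bivariation (R : realType) (a b c d : R) (g : R * R -> R)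
    : \bar R :=
  ereal_sup [set v : \bar R | exists xs ys : seq R,
    [/\ itv_partition a b xs, itv_partition c d ys
      & v = (bivariation a b c d g xs ys)%:E]].

Definition bounded_bivariation (R : realType) (a b c d : R)
    (g : R * R -> R) : Prop :=
  (total_bivariation a b c d g < +oo)%E.

Definition rs_sum2 (R : realType) (a b c d : R) (h g : R * R -> R)
    (xs ys : seq R) (xi eta : nat -> nat -> R) : R :=
  \sum_(i < size xs) \sum_(j < size ys)
    h (xi i j, eta i j) * Delta11 a b c d g xs ys i j.

Definition is_tag2 (R : realType) (a b c d : R) (xs ys : seq R)
    (xi eta : nat -> nat -> R) : Prop :=
  forall i j, (i < size xs)%N -> (j < size ys)%N ->
    node a b xs i <= xi i j <= node a b xs i.+1 /\
    node c d ys j <= eta i j <= node c d ys j.+1.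

Definition is_rs_integral2 (R : realType) (a b c d : R) (h g : R * R -> R)
    (I : R) : Prop :=
  forall e : R, 0 < e -> exists2 delta : R, 0 < delta &
    forall (xs ys : seq R) (xi eta : nat -> nat -> R),
      itv_partition a b xs -> itv_partition c d ys ->
      mesh a b xs < delta -> mesh c d ys < delta ->
      is_tag2 a b c d xs ys xi eta ->
      `|rs_sum2 a b c d h g xs ys xi eta - I| < e.

Definition rs_integrable2 (R : realType) (a b c d : R) (h g : R * R -> R)
    : Prop :=
  exists I, is_rs_integral2 a b c d h g I.

(* The Riemann-Stieltjes double integral of h with respect to g; an arbitrary
   value when rs_integrable2 a b c d h g fails. *)
Definition rs_integral2 (R : realType) (a b c d : R) (h g : R * R -> R) : R :=
  get (is_rs_integral2 a b c d h g).

Inductive variable := var_t | var_s.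

Definition diff_quot (R : realType) (v : variable) (f : R * R -> R)
    (p : R * R) (u : R) : R :=
  match v with
  | var_t => (f (u, p.2) - f p) / (u - p.1)
  | var_s => (f (p.1, u) - f p) / (u - p.2)
  end.

(* Punctured neighborhoods relative to the rectangle: partial derivatives are
   one-sided on its boundary, so that only the values of the function on the
   rectangle matter. *)
Definition var_nbhs (R : realType) (a b c d : R) (v : variable) (p : R * R)
    : set_system R :=
  match v with
  | var_t => within `[a, b]%classic p.1^'
  | var_s => within `[c, d]%classic p.2^'
  end.

Definition pderiv1 (R : realType) (a b c d : R) (v : variable)
    (f : R * R -> R) (p : R * R) : R :=
  lim (diff_quot v f p @ var_nbhs a b c d v p).

Definition pderivable1 (R : realType) (a b c d : R) (v : variable)
    (f : R * R -> R) : Prop :=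
  forall p, rect a b c d p -> cvg (diff_quot v f p @ var_nbhs a b c d v p).

(* Iterated partial derivatives; the head of w is the variable of the last
   differentiation, so w reads as the denominator in Leibniz notation. *)
Fixpoint pderiv (R : realType) (a b c d : R) (w : seq variable)
    (f : R * R -> R) : R * R -> R :=
  match w with
  | [::] => f
  | v :: w' => pderiv1 a b c d v (pderiv a b c d w' f)
  end.

Fixpoint pderivable (R : realType) (a b c d : R) (w : seq variable)
    (f : R * R -> R) : Prop :=
  match w with
  | [::] => True
  | v :: w' => pderivable a b c d w' f /\
               pderivable1 a b c d v (pderiv a b c d w' f)
  end.

Definition continuous_pderivs (R : realType) (a b c d : R) (m : nat)
    (f : R * R -> R) : Prop :=
  forall w : seq variable, size w = m ->
    pderivable a b c d w f /\
    {within rect a b c d, continuous (pderiv a b c d w f)}.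

Definition word (n j : nat) : seq variable :=
  nseq (n - j) var_t ++ nseq j var_s.

(* D^n_j f = d^n f / dt^(n-j) ds^j, for j <= n *)
Definition Dnj (R : realType) (a b c d : R) (n j : nat) (f : R * R -> R)
    : R * R -> R :=
  pderiv a b c d (word n j) f.

Definition Dnj_exists (R : realType) (a b c d : R) (n j : nat)
    (f : R * R -> R) : Prop :=
  pderivable a b c d (word n j) f.

Definition kernelM (R : realType) (a b c d : R) (n : nat) (p : R * R) : R :=
  let t := p.1 in
  let s := p.2 in
  let mt := (a + b) / 2 in
  let ms := (c + d) / 2 in
  (b - a) * (d - c) / (4 * n`!%:R) *
  (if t <= mt then
     if s <= ms then (mt - t) ^+ n * (ms - s) ^+ n
     else (-1) ^+ n.+1 * (mt - t) ^+ n * (s - ms) ^+ n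
   else
     if s <= ms then (-1) ^+ n.+1 * (t - mt) ^+ n * (ms - s) ^+ n
     else (t - mt) ^+ n * (s - ms) ^+ n).

Definition FM (R : realType) (a b c d : R) (n k : nat) (f : R * R -> R) : R :=
  1 / ((b - a) * (d - c)) *
  rs_integral2 a b c d (kernelM a b c d n) (Dnj a b c d n k f).

(* Main.v *)
Require Import Defs.
From mathcomp Require Import ring lra.

(** The statement is an instance of a general fact on Riemann-Stieltjes double
integrals: if [h] is continuous on the rectangle [Q] and [g] has finite total
bivariation [V], then the integral of [h] against [g] exists, and it is at most
[K * V] in absolute value as soon as [|h| <= K] on [Q].

The bound is immediate on Riemann-Stieltjes sums and passes to the limit.
Existence is a Cauchy argument ([rs_sum2_dist_le]): two sums over the grids
[P] and [P'] are both rewritten over the intersections of a cell of [P] with a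
cell of [P']. The increment of [g] over a cell is the sum of its increments
over these intersections ([sum_box_overlap]), so the difference of the two sums
is a sum of terms [(h p - h p') * m], where [m] is the increment over an
intersection and [p], [p'] are tags of two cells that meet. By uniform
continuity ([heine_rect]) every [|h p - h p'|] is small once the meshes are,
and the [|m|] add up to at most [V] ([sum_norm_box_overlap_le]), because the
nonempty intersections are, up to degenerate ones, the cells of one common
refinement ([overlap_chain]).

The kernel is a constant times a product of a function of [t] and a function of
[s] ([kernelME]). Each factor is a power of the distance to the midpoint, up to
a sign that changes only where the factor vanishes, whence continuity for
[n >= 1]; the distances are at most [(b - a) / 2] and [(d - c) / 2], whence
[norm_kernelM_le] and the constant of the theorem. *)

Set Implicit Arguments.
Unset Strict Implicit.
Unset Printing Implicit Defensive.

Local Open Scope classical_set_scope.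
Local Open Scope ring_scope.

(** * Sums over the cells of a partition and over intersections of cells *)

Section Partitions.
Variable R : realType.
Implicit Types (a b u v s t : R) (xs ys : seq R) (Phi : R -> R -> R).

Definition psum Phi a b xs : R :=
  \sum_(i < size xs) Phi (node a b xs i) (node a b xs i.+1).

Lemma psum_cons Phi a b x xs :
  psum Phi a b (x :: xs) = Phi a x + psum Phi x b xs.
Proof. by rewrite /psum /= big_ord_recl. Qed.

Lemma psum_cat Phi a b c xs ys : itv_partition a b xs ->
  psum Phi a c (xs ++ ys) = psum Phi a b xs + psum Phi b c ys.
Proof.
elim: xs a => [|x xs ih] a.
  by move=> /itv_partition_nil ->; rewrite /psum big_ord0 add0r.
by move=> /itv_partition_cons /ih; rewrite cat_cons !psum_cons -addrA => ->.
Qed.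

Lemma node_first a b xs : node a b xs 0 = a.
Proof. by []. Qed.

Lemma node_last a b xs : itv_partition a b xs -> node a b xs (size xs) = b.
Proof. exact: itv_partition_nth_size. Qed.

Lemma node_lt a b xs i : itv_partition a b xs -> (i < size xs)%N ->
  node a b xs i < node a b xs i.+1.
Proof. by case=> /(pathP b) + _ => /[apply]. Qed.

Lemma node_le a b xs i : itv_partition a b xs -> (i < size xs)%N ->
  node a b xs i <= node a b xs i.+1.
Proof. by move=> P /(node_lt P) /ltW. Qed.

Lemma node_itv a b xs i : itv_partition a b xs -> (i <= size xs)%N ->
  a <= node a b xs i <= b.
Proof.
by move=> P si; rewrite /node itv_partition_nth_ge// itv_partition_nth_le.
Qed.

Lemma node_mesh a b xs i : (i < size xs)%N ->
  node a b xs i.+1 - node a b xs i <= mesh a b xs.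
Proof.
move=> si; rewrite /mesh.
exact: (le_bigmax _ (fun i : 'I_(size xs) => node a b xs i.+1 - node a b xs i)
  (Ordinal si)).
Qed.

Definition vanish_diag Phi := forall x, Phi x x = 0.

(** [L] is summation over the cells of some genuine partition, as far as
functions of intervals that vanish on degenerate intervals can tell. This allows
gluing pieces that may contain repeated nodes, whereas a partition in the sense
of [itv_partition] must be strictly increasing; the partition is chosen
independently of the summand, so that it also serves in nested sums. *)
Definition is_psum a b (L : (R -> R -> R) -> R) :=
  exists2 xs, itv_partition a b xs &
    forall Phi, vanish_diag Phi -> L Phi = psum Phi a b xs.

Lemma is_psum_edge a b : a <= b -> is_psum a b (fun Phi => Phi a b).
Proof.
rewrite le_eqVlt => /predU1P[->|ab].
  by exists [::] => [|Phi Phi0]; [split=> //=|rewrite /psum big_ord0 Phi0].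
exists [:: b]; first exact: itv_partition1.
by move=> Phi _; rewrite /psum big_ord1.
Qed.

Lemma is_psum_glue (x : nat -> R) (L : nat -> (R -> R -> R) -> R) N :
  (forall i, (i < N)%N -> is_psum (x i) (x i.+1) (L i)) ->
  is_psum (x 0) (x N) (fun Phi => \sum_(i < N) L i Phi).
Proof.
elim: N => [_|N ih LN].
  by exists [::] => [|Phi _]; [split=> //=|rewrite /psum !big_ord0].
have [xs Pxs Exs] : is_psum (x 0) (x N) (fun Phi => \sum_(i < N) L i Phi).
  by apply: ih => i iN; apply: LN; rewrite ltnS ltnW.
have [ys Pys Eys] := LN N (ltnSn N).
exists (xs ++ ys); first exact: itv_partition_cat Pys.
by move=> Phi Phi0; rewrite big_ord_recr /= Exs// Eys// (psum_cat _ _ _ Pxs).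
Qed.

(** Disjoint intervals contribute 0. Unlike an explicit common refinement of two
partitions, it is visibly symmetric in the two intervals. *)
Definition overlap Phi u v s t : R :=
  if Num.max u s <= Num.min v t then Phi (Num.max u s) (Num.min v t) else 0.

Lemma overlapC Phi u v s t : overlap Phi u v s t = overlap Phi s t u v.
Proof. by rewrite /overlap maxC minC. Qed.

Lemma eq_overlap Phi Psi u v s t :
  (forall p q, Phi p q = Psi p q) -> overlap Phi u v s t = overlap Psi u v s t.
Proof. by rewrite /overlap => ->. Qed.

Lemma overlap_sum n (Phi : 'I_n -> R -> R -> R) u v s t :
  overlap (fun p q => \sum_l Phi l p q) u v s t =
  \sum_l overlap (Phi l) u v s t.
Proof. by rewrite /overlap; case: ifP => // _; rewrite big1. Qed.

Lemma norm_overlap Phi u v s t :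
  `|overlap Phi u v s t| = overlap (fun p q => `|Phi p q|) u v s t.
Proof. by rewrite /overlap; case: ifP => // _; rewrite normr0. Qed.

Definition clamp u v s : R := Num.max u (Num.min v s).

(** Clamping to [u, v] is monotone and defined on the whole line: it turns the
intersections of [u, v] with the successive cells of a partition into
consecutive intervals, over which sums telescope. When the intersection is
empty, both endpoints are clamped to the same end of [u, v]. *)
Lemma overlap_clamp Phi u v s t : vanish_diag Phi -> u <= v -> s <= t ->
  overlap Phi u v s t = Phi (clamp u v s) (clamp u v t).
Proof.
move=> Phi0 uv st; rewrite /overlap /clamp; case: ifP => [|/negbT].
  rewrite ge_max !le_min => /andP[/andP[_ ut] /andP[sv _]].
  by rewrite (min_r sv) [in RHS](@max_r _ _ _ (Num.min v t))// le_min uv.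
rewrite ge_max !le_min uv st andbT /=.
rewrite negb_and -!ltNge => /orP[tu|vs].
  rewrite !max_l// ge_min ?(ltW tu) ?orbT//.
  by rewrite (ltW (le_lt_trans st tu)) orbT.
by rewrite !min_l ?(ltW vs)// (le_trans (ltW vs) st).
Qed.

Lemma le_clamp u v s t : s <= t -> clamp u v s <= clamp u v t.
Proof.
move=> st.
by rewrite /clamp ge_max !le_max lexx /= le_min !ge_min lexx st !orbT.
Qed.

(** This is the common refinement of two partitions: inside each cell of [xs]
the clamped nodes of [ys] form a chain from one end to the other, and the chains
of successive cells are glued together. *)
Lemma overlap_chain a b xs ys : itv_partition a b xs -> itv_partition a b ys ->
  exists2 zs, itv_partition a b zs & forall Phi, vanish_diag Phi ->
    \sum_(i < size xs) \sum_(k < size ys)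
      overlap Phi (node a b xs i) (node a b xs i.+1)
                  (node a b ys k) (node a b ys k.+1) = psum Phi a b zs.
Proof.
move=> Pxs Pys.
have cells i : (i < size xs)%N ->
    is_psum (node a b xs i) (node a b xs i.+1)
      (fun Phi => \sum_(k < size ys)
        Phi (clamp (node a b xs i) (node a b xs i.+1) (node a b ys k))
            (clamp (node a b xs i) (node a b xs i.+1) (node a b ys k.+1))).
  move=> ix; set u := node a b xs i; set v := node a b xs i.+1.
  have uv : u <= v by exact: node_le.
  have [/andP[au _] /andP[_ vb]] : a <= u <= b /\ a <= v <= b.
    by split; apply: node_itv => //; exact: ltnW.
  pose w k := clamp u v (node a b ys k).
  have w0 : w 0 = u.
    by rewrite /w node_first /clamp min_r ?max_l// (le_trans au).
  have wN : w (size ys) = v.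
    by rewrite /w node_last// /clamp min_l ?max_r.
  have := @is_psum_glue w (fun k Phi => Phi (w k) (w k.+1)) (size ys).
  rewrite w0 wN; apply=> k kys.
  by apply: is_psum_edge; apply/le_clamp/node_le.
have [zs Pzs Ezs] := is_psum_glue cells.
rewrite node_first node_last// in Pzs Ezs.
exists zs => // Phi Phi0; rewrite -Ezs//.
apply: eq_bigr => i _; apply: eq_bigr => k _.
by apply: overlap_clamp => //; exact: node_le.
Qed.

(** The sum telescopes after clamping; the end terms are [G u] and [G v] because
the partition covers [u, v]. *)
Lemma sum_overlap a b ys u v (G : R -> R) :
  itv_partition a b ys -> a <= u -> u <= v -> v <= b ->
  \sum_(k < size ys) overlap (fun p q => G q - G p) u v
    (node a b ys k) (node a b ys k.+1) = G v - G u.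
Proof.
move=> Pys au uv vb.
under eq_bigr => k _.
  rewrite overlap_clamp//; last exact: node_le.
    over.
  by move=> x; rewrite subrr.
rewrite -(big_mkord xpredT (fun k => G (clamp u v (node a b ys k.+1)) -
  G (clamp u v (node a b ys k)))) telescope_sumr// node_first node_last//.
by rewrite /clamp min_l// max_r// min_r ?max_l// (le_trans au).
Qed.
End Partitions.

(** * Increments over boxes and Riemann-Stieltjes double sums *)

Section DoubleSums.
Variables (R : realType) (a b c d : R).
Implicit Types (g h : R * R -> R) (xs ys : seq R) (u v s t : R).

Definition box_incr g u v s t : R :=
  g (u, s) - g (u, t) - g (v, s) + g (v, t).

(** The increment of [g] over the intersection of the boxes [u, v] x [s, t] and
[u', v'] x [s', t']. *)
Definition box_overlap g u v u' v' s t s' t' : R :=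
  overlap (fun p q => overlap (box_incr g p q) s t s' t') u v u' v'.

Lemma box_overlapC g u v u' v' s t s' t' :
  box_overlap g u v u' v' s t s' t' = box_overlap g u' v' u v s' t' s t.
Proof.
rewrite /box_overlap overlapC; apply: eq_overlap => p q; exact: overlapC.
Qed.

Lemma box_overlap_neq0 g u v u' v' s t s' t' :
  box_overlap g u v u' v' s t s' t' != 0 ->
  [/\ Num.max u u' <= Num.min v v' & Num.max s s' <= Num.min t t'].
Proof.
rewrite /box_overlap /overlap; case: ifP => [xx|_]; last by rewrite eqxx.
by case: ifP => [yy|_]; last by rewrite eqxx.
Qed.

(** With one variable frozen, the increment is a difference of values of a
function of the other variable, so the one-dimensional additivity applies
twice. *)
Lemma sum_box_overlap g xs ys u v s t :
  itv_partition a b xs -> itv_partition c d ys ->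
  a <= u -> u <= v -> v <= b -> c <= s -> s <= t -> t <= d ->
  \sum_(k < size xs) \sum_(l < size ys)
    box_overlap g u v (node a b xs k) (node a b xs k.+1)
                  s t (node c d ys l) (node c d ys l.+1) = box_incr g u v s t.
Proof.
move=> Pxs Pys au uv vb cs st td.
have incr_s p q r w : box_incr g p q r w =
    (g (q, w) - g (p, w)) - (g (q, r) - g (p, r)) by rewrite /box_incr; ring.
have incr_t p q r w : box_incr g p q r w =
    (g (q, w) - g (q, r)) - (g (p, w) - g (p, r)) by rewrite /box_incr; ring.
have inner p q : \sum_(l < size ys) overlap (box_incr g p q) s t
    (node c d ys l) (node c d ys l.+1) = box_incr g p q s t.
  rewrite incr_s -(sum_overlap (fun w => g (q, w) - g (p, w)) Pys)//.
  by apply: eq_bigr => l _; apply: eq_overlap => r w.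
rewrite incr_t -(sum_overlap (fun p => g (p, t) - g (p, s)) Pxs)//.
apply: eq_bigr => k _; rewrite -overlap_sum; apply: eq_overlap => p q.
by rewrite inner.
Qed.

(** The intersections of the cells of two grids form the grid [zs], [ws] of the
common refinements in each direction, up to boxes on which the increment is
zero. *)
Lemma sum_norm_box_overlap_le g V xs xs' ys ys' :
  (forall zs ws, itv_partition a b zs -> itv_partition c d ws ->
    bivariation a b c d g zs ws <= V) ->
  itv_partition a b xs -> itv_partition a b xs' ->
  itv_partition c d ys -> itv_partition c d ys' ->
  \sum_(i < size xs) \sum_(j < size ys)
    \sum_(k < size xs') \sum_(l < size ys')
      `|box_overlap g (node a b xs i) (node a b xs i.+1)
                      (node a b xs' k) (node a b xs' k.+1)
                      (node c d ys j) (node c d ys j.+1)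
                      (node c d ys' l) (node c d ys' l.+1)| <= V.
Proof.
move=> gV Pxs Pxs' Pys Pys'.
have [zs Pzs Ezs] := overlap_chain Pxs Pxs'.
have [ws Pws Ews] := overlap_chain Pys Pys'.
suff -> : \sum_(i < size xs) \sum_(j < size ys)
    \sum_(k < size xs') \sum_(l < size ys')
      `|box_overlap g (node a b xs i) (node a b xs i.+1)
                      (node a b xs' k) (node a b xs' k.+1)
                      (node c d ys j) (node c d ys j.+1)
                      (node c d ys' l) (node c d ys' l.+1)| =
    bivariation a b c d g zs ws by exact: gV.
transitivity (psum (fun p q => psum (fun r w => `|box_incr g p q r w|) c d ws)
  a b zs); last by [].
rewrite -Ezs; last first.
  move=> p; rewrite /psum big1// => j _.
  by apply/normr0P; rewrite /box_incr; apply/eqP; ring.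
apply: eq_bigr => i _; rewrite exchange_big /=; apply: eq_bigr => k _.
under [RHS]eq_overlap => p q.
  rewrite -Ews; last first.
    by move=> r; apply/normr0P; rewrite /box_incr; apply/eqP; ring.
  over.
rewrite (overlap_sum (fun j p q => \sum_(l < size ys') _)).
apply: eq_bigr => j _.
rewrite (overlap_sum (fun l p q => overlap _ _ _ _ _)).
apply: eq_bigr => l _.
rewrite norm_overlap; apply: eq_overlap => p q; exact: norm_overlap.
Qed.

Lemma tag_close (x y u v u' v' e : R) :
  Num.max u u' <= Num.min v v' -> u <= x <= v -> u' <= y <= v' ->
  v - u < e -> v' - u' < e -> `|x - y| < e + e.
Proof.
rewrite ge_max !le_min => /andP[/andP[_ uv'] /andP[u'v _]].
move=> /andP[? ?] /andP[? ?] ? ?.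
by rewrite ltr_norml; apply/andP; split; lra.
Qed.

Lemma node_rect xs ys xi eta i j :
  itv_partition a b xs -> itv_partition c d ys ->
  is_tag2 a b c d xs ys xi eta -> (i < size xs)%N -> (j < size ys)%N ->
  rect a b c d (xi i j, eta i j).
Proof.
move=> Pxs Pys tag ix jy; have [/andP[x1 x2] /andP[y1 y2]] := tag i j ix jy.
have /andP[a1 _] := node_itv Pxs (ltnW ix).
have /andP[_ b1] := node_itv Pxs ix.
have /andP[c1 _] := node_itv Pys (ltnW jy).
have /andP[_ d1] := node_itv Pys jy.
split; rewrite /= in_itv/= ?(le_trans a1 x1) ?(le_trans x2 b1)//.
by rewrite (le_trans c1 y1) (le_trans y2 d1).
Qed.

(** The Cauchy estimate. Tags are at distance less than [delta + delta] because
only pairs of cells that meet contribute. *)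
Lemma rs_sum2_dist_le g h V e delta xs ys xi eta xs' ys' xi' eta' :
  (forall zs ws, itv_partition a b zs -> itv_partition c d ws ->
    bivariation a b c d g zs ws <= V) -> 0 <= e ->
  (forall p q, rect a b c d p -> rect a b c d q ->
    `|p.1 - q.1| < delta + delta -> `|p.2 - q.2| < delta + delta ->
    `|h p - h q| <= e) ->
  itv_partition a b xs -> itv_partition c d ys ->
  mesh a b xs < delta -> mesh c d ys < delta ->
  is_tag2 a b c d xs ys xi eta ->
  itv_partition a b xs' -> itv_partition c d ys' ->
  mesh a b xs' < delta -> mesh c d ys' < delta ->
  is_tag2 a b c d xs' ys' xi' eta' ->
  `|rs_sum2 a b c d h g xs ys xi eta - rs_sum2 a b c d h g xs' ys' xi' eta'|
    <= e * V.
Proof.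
move=> gV e0 he Pxs Pys mx my tag Pxs' Pys' mx' my' tag'.
pose D i j k l := box_overlap g (node a b xs i) (node a b xs i.+1)
  (node a b xs' k) (node a b xs' k.+1) (node c d ys j) (node c d ys j.+1)
  (node c d ys' l) (node c d ys' l.+1).
have E : rs_sum2 a b c d h g xs ys xi eta = \sum_(i < size xs)
    \sum_(j < size ys) \sum_(k < size xs') \sum_(l < size ys')
      h (xi i j, eta i j) * D i j k l.
  apply: eq_bigr => i _; apply: eq_bigr => j _.
  under [RHS]eq_bigr => k _ do rewrite -mulr_sumr.
  rewrite -mulr_sumr; congr (_ * _).
  have /andP[? _] := node_itv Pxs (ltnW (ltn_ord i)).
  have /andP[_ ?] := node_itv Pxs (ltn_ord i).
  have /andP[? _] := node_itv Pys (ltnW (ltn_ord j)).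
  have /andP[_ ?] := node_itv Pys (ltn_ord j).
  by rewrite sum_box_overlap//; exact: node_le.
(* The intersections are now grouped by the cells of the second grid. *)
have E' : rs_sum2 a b c d h g xs' ys' xi' eta' = \sum_(i < size xs)
    \sum_(j < size ys) \sum_(k < size xs') \sum_(l < size ys')
      h (xi' k l, eta' k l) * D i j k l.
  transitivity (\sum_(k < size xs') \sum_(l < size ys')
    \sum_(i < size xs) \sum_(j < size ys) h (xi' k l, eta' k l) * D i j k l).
    apply: eq_bigr => k _; apply: eq_bigr => l _.
    under [RHS]eq_bigr => i _ do rewrite -mulr_sumr.
    rewrite -mulr_sumr; congr (_ * _).
    have /andP[? _] := node_itv Pxs' (ltnW (ltn_ord k)).
    have /andP[_ ?] := node_itv Pxs' (ltn_ord k).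
    have /andP[? _] := node_itv Pys' (ltnW (ltn_ord l)).
    have /andP[_ ?] := node_itv Pys' (ltn_ord l).
    under eq_bigr => i _ do under eq_bigr => j _ do rewrite /D box_overlapC.
    by rewrite sum_box_overlap//; exact: node_le.
  under eq_bigr => k _ do rewrite exchange_big /=.
  rewrite exchange_big /=; apply: eq_bigr => i _.
  under eq_bigr => k _ do rewrite exchange_big /=.
  by rewrite exchange_big.
rewrite E E' -sumrB.
apply: (@le_trans _ _ (e * \sum_(i < size xs) \sum_(j < size ys)
    \sum_(k < size xs') \sum_(l < size ys') `|D i j k l|)); last first.
  by apply: ler_wpM2l => //; exact: sum_norm_box_overlap_le.
rewrite mulr_sumr (le_trans (ler_norm_sum _ _ _))//; apply: ler_sum => i _.
rewrite -sumrB mulr_sumr (le_trans (ler_norm_sum _ _ _))//.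
apply: ler_sum => j _.
rewrite -sumrB mulr_sumr (le_trans (ler_norm_sum _ _ _))//.
apply: ler_sum => k _.
rewrite -sumrB mulr_sumr (le_trans (ler_norm_sum _ _ _))//.
apply: ler_sum => l _.
rewrite -mulrBl normrM.
have [->|/box_overlap_neq0[xx yy]] := eqVneq (D i j k l) 0.
  by rewrite normr0 !mulr0.
apply: ler_wpM2r => //.
have [x1 y1] := tag i j (ltn_ord _) (ltn_ord _).
have [x2 y2] := tag' k l (ltn_ord _) (ltn_ord _).
apply: he; [exact: (node_rect Pxs Pys)|exact: (node_rect Pxs' Pys')| |].
- by apply: (tag_close xx) => //; exact: le_lt_trans (node_mesh a b _) _.
- by apply: (tag_close yy) => //; exact: le_lt_trans (node_mesh c d _) _.
Qed.

Lemma norm_rs_sum2_le g h V K xs ys xi eta :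
  (forall zs ws, itv_partition a b zs -> itv_partition c d ws ->
    bivariation a b c d g zs ws <= V) -> 0 <= K ->
  (forall p, rect a b c d p -> `|h p| <= K) ->
  itv_partition a b xs -> itv_partition c d ys ->
  is_tag2 a b c d xs ys xi eta ->
  `|rs_sum2 a b c d h g xs ys xi eta| <= K * V.
Proof.
move=> gV K0 hK Pxs Pys tag.
apply: le_trans (ler_wpM2l K0 (gV _ _ Pxs Pys)).
rewrite mulr_sumr (le_trans (ler_norm_sum _ _ _))//; apply: ler_sum => i _.
rewrite mulr_sumr (le_trans (ler_norm_sum _ _ _))//; apply: ler_sum => j _.
by rewrite normrM; apply: ler_wpM2r => //; apply/hK/(node_rect Pxs Pys tag).
Qed.

End DoubleSums.

(** * Existence and size of the double integral *)

Lemma fine_itv_partition (R : realType) (a b delta : R) : a < b -> 0 < delta ->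
  exists2 xs, itv_partition a b xs & mesh a b xs < delta.
Proof.
move=> ab d0; have ba0 : 0 < b - a by rewrite subr_gt0.
have [N hN] : exists N : nat, (b - a) / delta < N.+1%:R.
  exists (Num.truncn ((b - a) / delta)); rewrite truncnS_gt//.
have N0 : 0 < N.+1%:R :> R by rewrite ltr0n.
have hstep : (b - a) / N.+1%:R < delta.
  by rewrite ltr_pdivrMr// mulrC -ltr_pdivrMr.
pose xs := mkseq (fun i => a + (b - a) / N.+1%:R * i.+1%:R) N.+1.
have szxs : size xs = N.+1 by rewrite size_mkseq.
have nodeE i : (i <= N.+1)%N -> node a b xs i = a + (b - a) / N.+1%:R * i%:R.
  case: i => [_|i iN]; first by rewrite node_first mulr0 addr0.
  by rewrite /node /= nth_mkseq.
have stepE i : (i < N.+1)%N ->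
    node a b xs i.+1 - node a b xs i = (b - a) / N.+1%:R.
  by move=> iN; rewrite !nodeE ?(ltnW iN)// -natr1; ring.
exists xs.
  split.
    apply/(pathP b) => i; rewrite szxs => iN.
    have := stepE i iN; rewrite /node /= => E.
    by rewrite -subr_gt0 E divr_gt0.
  rewrite (last_nth b) szxs -/(node a b xs N.+1) nodeE//.
  by rewrite divfK ?lt0r_neq0// addrC subrK.
apply: bigmax_lt => // i _.
by have iN : (i < N.+1)%N; [rewrite -szxs|rewrite stepE].
Qed.

(** Heine's theorem, from the covering form of compactness: around each point
[x], half of a radius at which [h] varies by less than [e / 2] serves both for
the neighborhood of [x] and for [delta]. *)
Lemma heine_rect (R : realType) (a b c d : R) (h : R * R -> R) (e : R) :
  {within rect a b c d, continuous h} -> 0 < e ->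
  exists2 delta, 0 < delta & forall p q, rect a b c d p -> rect a b c d q ->
    `|p.1 - q.1| < delta -> `|p.2 - q.2| < delta -> `|h p - h q| < e.
Proof.
move=> /subspace_continuousP ch e0.
have cQ : compact (rect a b c d).
  by apply: compact_setX; exact: segment_compact.
have e20 : 0 < e / 2 by rewrite divr_gt0.
have := (@compact_near_coveringP _ (rect a b c d)).1 cQ _ (0^'+ : set_system R)
  (fun delta p => rect a b c d p -> forall q, rect a b c d q ->
     `|p.1 - q.1| < delta -> `|p.2 - q.2| < delta -> `|h p - h q| < e) _.
have -/[swap]/[apply] : forall x, rect a b c d x ->
    \forall x' \near x & delta \near 0^'+, rect a b c d x' ->
      forall q, rect a b c d q ->
      `|x'.1 - q.1| < delta -> `|x'.2 - q.2| < delta -> `|h x' - h q| < e.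
  move=> x Qx.
  have /cvgrPdist_lt/(_ _ e20) := ch x Qx.
  rewrite /within /= => /nbhs_ballP[r /= r0 xr].
  have r20 : 0 < r / 2 by rewrite divr_gt0.
  exists (ball x (r / 2), [set y | y < r / 2]); first split=> /=.
  - exact: nbhsx_ballx.
  - exact: nbhs_right_lt.
  move=> [y delta] [/= xy ydelta] Qy q Qq yq1 yq2.
  have hy : `|h x - h y| < e / 2.
    by apply: xr => //; apply: le_ball xy; lra.
  have hq : `|h x - h q| < e / 2.
    apply: xr => //; rewrite (_ : r = r / 2 + r / 2); last by lra.
    apply: (ball_triangle xy); split; rewrite -ball_normE /ball_ /=;
      exact: lt_trans ydelta.
  rewrite (_ : h y - h q = (h x - h q) - (h x - h y)); last by ring.
  by rewrite (le_lt_trans (ler_normB _ _))// (splitr e) ltrD.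
move=> nearQ.
have [delta [d0 hd]] : exists delta : R, 0 < delta /\ rect a b c d `<=`
   (fun p => rect a b c d p -> forall q, rect a b c d q ->
     `|p.1 - q.1| < delta -> `|p.2 - q.2| < delta -> `|h p - h q| < e).
  near (0 : R)^'+ => delta; exists delta; split=> //.
  by near: delta.
by exists delta => // p q Qp Qq; exact: hd.
Unshelve. all: by end_near. Qed.

Section Existence.
Variables (R : realType) (a b c d : R).
Hypotheses (ab : a < b) (cd : c < d).
Implicit Types (g h : R * R -> R).

Lemma total_bivariation_fin_num g : bounded_bivariation a b c d g ->
  total_bivariation a b c d g \is a fin_num.
Proof.
move=> gBV; rewrite fin_numElt gBV andbT.
apply: (@lt_le_trans _ _ (bivariation a b c d g [:: b] [:: d])%:E).
  exact: ltNyr.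
by apply: ereal_sup_ubound; exists [:: b], [:: d]; split=> //;
  exact: itv_partition1.
Qed.

Lemma bivariation_le_total g xs ys : bounded_bivariation a b c d g ->
  itv_partition a b xs -> itv_partition c d ys ->
  bivariation a b c d g xs ys <= fine (total_bivariation a b c d g).
Proof.
move=> gBV Pxs Pys.
rewrite -lee_fin fineK; last exact: total_bivariation_fin_num.
by apply: ereal_sup_ubound; exists xs, ys.
Qed.

(** The filter of Riemann-Stieltjes sums as the mesh tends to 0: convergence of
this filter to [I] is [is_rs_integral2 a b c d h g I], so that the existence of
the integral reduces to completeness of the real line. *)
Definition fine_rs_sums h g : set_system R := fun A =>
  exists2 delta : R, 0 < delta &
    forall (xs ys : seq R) (xi eta : nat -> nat -> R),
      itv_partition a b xs -> itv_partition c d ys ->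
      mesh a b xs < delta -> mesh c d ys < delta ->
      is_tag2 a b c d xs ys xi eta ->
      A (rs_sum2 a b c d h g xs ys xi eta).

Lemma fine_tagged_grid (delta : R) : 0 < delta ->
  exists xs ys xi eta, [/\ itv_partition a b xs, itv_partition c d ys,
    mesh a b xs < delta, mesh c d ys < delta & is_tag2 a b c d xs ys xi eta].
Proof.
move=> d0.
have [xs Pxs mx] := fine_itv_partition ab d0.
have [ys Pys my] := fine_itv_partition cd d0.
exists xs, ys, (fun i _ => node a b xs i), (fun _ j => node c d ys j).
by split=> // i j ix jy; rewrite !lexx !node_le.
Qed.

Instance fine_rs_sums_filter h g : ProperFilter (fine_rs_sums h g).
Proof.
split.
  move=> [delta /fine_tagged_grid[xs [ys [xi [eta [Px Py mx my tag]]]]] F].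
  exact: (F xs ys xi eta).
split.
- by exists 1.
- move=> A B [r r0 rA] [s s0 sB]; exists (Num.min r s).
    by rewrite lt_min r0.
  move=> xs ys xi eta Px Py; rewrite !lt_min => /andP[? ?] /andP[? ?] tag.
  by split; [exact: rA|exact: sB].
- move=> A B AB [r r0 rA]; exists r => // xs ys xi eta Px Py mx my tag.
  exact/AB/rA.
Qed.

Theorem continuous_rs_integrable2 h g :
  {within rect a b c d, continuous h} -> bounded_bivariation a b c d g ->
  rs_integrable2 a b c d h g.
Proof.
move=> ch gBV.
pose V := fine (total_bivariation a b c d g).
have gV zs ws : itv_partition a b zs -> itv_partition c d ws ->
    bivariation a b c d g zs ws <= V by exact: bivariation_le_total.
have V0 : 0 <= V.
  apply: le_trans (gV _ _ (itv_partition1 ab) (itv_partition1 cd)).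
  by apply: sumr_ge0 => i _; apply: sumr_ge0.
suff /cauchy_cvg : cauchy (fine_rs_sums h g).
  move=> /cvg_ex[I FI]; exists I => e e0.
  have := FI _ (nbhsx_ballx I e e0).
  move=> [delta d0 hd]; exists delta => // xs ys xi eta Px Py mx my tag.
  by have := hd xs ys xi eta Px Py mx my tag; rewrite -ball_normE /= distrC.
apply: cauchy_exP => e e0.
(* [V] may vanish, hence the division by [V + 1]. *)
have V10 : 0 < V + 1 by rewrite ltr_wpDl.
have [r r0 hr] := heine_rect ch (divr_gt0 e0 V10).
have r20 : 0 < r / 2 by rewrite divr_gt0.
have [xs [ys [xi [eta [Px Py mx my tag]]]]] := fine_tagged_grid r20.
exists (rs_sum2 a b c d h g xs ys xi eta), (r / 2) => //.
move=> xs' ys' xi' eta' Px' Py' mx' my' tag'.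
rewrite -ball_normE /=.
apply: (@le_lt_trans _ _ (e / (V + 1) * V)).
  apply: (rs_sum2_dist_le gV _ _ Px Py mx my tag Px' Py' mx' my' tag').
    by rewrite divr_ge0 ?ltW.
  by move=> p q Qp Qq pq1 pq2; apply/ltW/hr => //; rewrite (splitr r).
rewrite mulrAC ltr_pdivrMr// ltr_pM2l//; lra.
Qed.

(** Stated for any value [I] of the integral, so that it applies to the chosen
value [rs_integral2] without a proof of uniqueness. *)
Theorem norm_rs_integral2_le h g (K I : R) : bounded_bivariation a b c d g ->
  (forall p, rect a b c d p -> `|h p| <= K) -> is_rs_integral2 a b c d h g I ->
  `|I| <= K * fine (total_bivariation a b c d g).
Proof.
move=> gBV hK hI.
have K0 : 0 <= K.
  apply: le_trans (hK (a, c) _) => //.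
  by split; rewrite /= in_itv/= lexx ltW.
apply/ler_addgt0Pr => e e0; have [delta d0 Hd] := hI e e0.
have [xs [ys [xi [eta [Px Py mx my tag]]]]] := fine_tagged_grid d0.
have SI := Hd _ _ _ _ Px Py mx my tag.
have gV zs ws : itv_partition a b zs -> itv_partition c d ws ->
    bivariation a b c d g zs ws <= fine (total_bivariation a b c d g).
  exact: bivariation_le_total.
have := norm_rs_sum2_le gV K0 hK Px Py tag.
move: SI; set S := rs_sum2 _ _ _ _ _ _ _ _ _ _ => SI SK.
rewrite (_ : I = S - (S - I)); last by ring.
by rewrite (le_trans (ler_normB _ _))// lerD// ltW.
Qed.
End Existence.

(** * The kernel *)

Section Kernel.
Variable R : realType.

(** The function equal to [(m - t) ^+ n] left of [m] and to
[(-1) ^+ n.+1 * (t - m) ^+ n] right of it, written with positive parts so that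
its continuity at [m] needs no gluing; for [n = 0] the two descriptions
differ. *)
Definition kernel_factor n (m t : R) : R :=
  Num.max (m - t) 0 ^+ n + (-1) ^+ n.+1 * Num.max (t - m) 0 ^+ n.

Lemma kernel_factor_le n (m t : R) : (0 < n)%N -> t <= m ->
  kernel_factor n m t = (m - t) ^+ n.
Proof.
move=> n0 tm; rewrite /kernel_factor max_l ?subr_ge0// max_r ?subr_le0//.
by rewrite expr0n -[n == 0]negbK -lt0n n0 mulr0 addr0.
Qed.

Lemma kernel_factor_gt n (m t : R) : (0 < n)%N -> m < t ->
  kernel_factor n m t = (-1) ^+ n.+1 * (t - m) ^+ n.
Proof.
move=> n0 /ltW mt; rewrite /kernel_factor max_r ?subr_le0// max_l ?subr_ge0//.
by rewrite expr0n -[n == 0]negbK -lt0n n0 add0r.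
Qed.

(** On the quadrant where both variables exceed the midpoints, the two signs
[(-1) ^+ n.+1] cancel. *)
Lemma kernelME (a b c d : R) n (p : R * R) : (0 < n)%N ->
  kernelM a b c d n p = (b - a) * (d - c) / (4 * n`!%:R) *
    (kernel_factor n ((a + b) / 2) p.1 * kernel_factor n ((c + d) / 2) p.2).
Proof.
move=> n0; rewrite /kernelM; congr (_ * _).
case: leP => [tm|mt]; [rewrite (kernel_factor_le n0 tm)|
                       rewrite (kernel_factor_gt n0 mt)];
  (case: leP => [sm|ms]; [rewrite (kernel_factor_le n0 sm)|
                          rewrite (kernel_factor_gt n0 ms)]) => //.
- by rewrite mulrCA mulrA.
- by rewrite mulrACA -expr2 sqrr_sign mul1r.
Qed.

Lemma norm_kernel_factor_le (a b : R) n t : (0 < n)%N -> a <= t <= b ->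
  `|kernel_factor n ((a + b) / 2) t| <= ((b - a) / 2) ^+ n.
Proof.
move=> n0 /andP[a_t t_b]; case: (leP t ((a + b) / 2)) => h.
  rewrite kernel_factor_le// normrX; apply: lerXn2r; rewrite ?nnegrE//.
    lra.
  by rewrite ger0_norm; lra.
rewrite kernel_factor_gt// normrMsign normrX.
apply: lerXn2r; rewrite ?nnegrE//; first lra.
by rewrite ger0_norm; lra.
Qed.

Lemma continuous_kernel_factor n (m : R) : continuous (kernel_factor n m).
Proof.
have continuous_pow (u : R -> R) : continuous u ->
    continuous (fun x => Num.max (u x) 0 ^+ n).
  move=> cu x.
  apply: (@continuous_comp _ _ _ (fun x => Num.max (u x) 0) (fun x => x ^+ n)).
    by apply: continuous_max; [exact: cu|exact: cvg_cst].
  exact: exprn_continuous.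
move=> t; apply: cvgD.
  apply: (continuous_pow (fun x => m - x)) => x.
  by apply: cvgB; [exact: cvg_cst|exact: cvg_id].
apply: cvgM; first exact: cvg_cst.
apply: (continuous_pow (fun x => x - m)) => x.
by apply: cvgB; [exact: cvg_id|exact: cvg_cst].
Qed.

Lemma continuous_kernelM (a b c d : R) n : (0 < n)%N ->
  continuous (kernelM a b c d n).
Proof.
move=> n0; pose F (p : R * R) := (b - a) * (d - c) / (4 * n`!%:R) *
    (kernel_factor n ((a + b) / 2) p.1 * kernel_factor n ((c + d) / 2) p.2).
have -> : kernelM a b c d n = F by apply/funext => p; exact: kernelME.
move=> p; apply: cvgM; first exact: cvg_cst.
apply: cvgM.
  apply: (@continuous_comp _ _ _ fst (kernel_factor n _)); first exact: cvg_fst.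
  exact: continuous_kernel_factor.
apply: (@continuous_comp _ _ _ snd (kernel_factor n _)); first exact: cvg_snd.
exact: continuous_kernel_factor.
Qed.

Lemma norm_kernelM_le (a b c d : R) n p : (0 < n)%N -> a < b -> c < d ->
  rect a b c d p -> `|kernelM a b c d n p| <=
    (b - a) * (d - c) *
      ((b - a) ^+ n * (d - c) ^+ n / (2 ^+ (2 * n + 2) * n`!%:R)).
Proof.
move=> n0 ab cd [/= tab scd]; rewrite !in_itv /= in tab scd.
have nf0 : 0 < n`!%:R :> R by rewrite ltr0n fact_gt0.
have C0 : 0 <= (b - a) * (d - c) / (4 * n`!%:R).
  by rewrite divr_ge0 ?mulr_ge0 ?subr_ge0 ?ltW.
rewrite kernelME// normrM (ger0_norm C0) normrM.
apply: le_trans (ler_wpM2l C0 (ler_pM _ _ (norm_kernel_factor_le n0 tab)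
  (norm_kernel_factor_le n0 scd))) _ => //.
have w0 : (2 : R) ^+ n != 0 by rewrite expf_neq0// pnatr_eq0.
rewrite !expr_div_n mulnC exprD exprM le_eqVlt; apply/orP; left; apply/eqP.
by field; rewrite w0 gt_eqF.
Qed.
End Kernel.

Theorem corollary2 (R : realType) (a b c d : R) (hab : a < b) (hcd : c < d)
    (n : nat) (hn : (1 <= n)%N) (f : R * R -> R)
    (hf : continuous_pderivs a b c d n.-1 f)
    (hD : forall j : nat, (j <= n)%N -> Dnj_exists a b c d n j f)
    (hBV : forall j : nat, (j <= n)%N ->
       bounded_bivariation a b c d (Dnj a b c d n j f)) :
  forall k : nat, (k <= n)%N ->
    rs_integrable2 a b c d (kernelM a b c d n) (Dnj a b c d n k f) /\
    (`|FM a b c d n k f|%:E <=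
       ((b - a) ^+ n * (d - c) ^+ n / (2 ^+ (2 * n + 2) * n`!%:R))%:E *
       total_bivariation a b c d (Dnj a b c d n k f))%E.
Proof.
move=> k kn; have gBV := hBV k kn.
have integrable :
    rs_integrable2 a b c d (kernelM a b c d n) (Dnj a b c d n k f).
  apply: continuous_rs_integrable2 => //.
  by apply: continuous_subspaceT; exact: continuous_kernelM.
split=> //.
have area0 : 0 < (b - a) * (d - c) by rewrite mulr_gt0 ?subr_gt0.
have := norm_rs_integral2_le hab hcd gBV (fun p => norm_kernelM_le hn hab hcd)
  (getPex integrable).
rewrite -/(rs_integral2 a b c d (kernelM a b c d n) (Dnj a b c d n k f)).
move=> le_I.
rewrite -(fineK (total_bivariation_fin_num hab hcd gBV)) -EFinM lee_fin.
by rewrite /FM div1r normrM gtr0_norm ?invr_gt0// [leLHS]mulrC ler_pdivrMr//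
  [leRHS]mulrC mulrA.
Qed.
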